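(* Let $0<a<b$, and for $i=1,2$ let $f_i:[a,b]\to\mathbb{R}^{p_i}$ be continuously differentiable with linearly independent components. Consider the continuous time regression model $$\begin{pmatrix}Y_1(t)\\ Y_2(t)\end{pmatrix}=\begin{pmatrix}f_1^\top(t)&0_{p_2}^\top\\0_{p_1}^\top&f_2^\top(t)\end{pmatrix}\begin{pmatrix}\theta^{(1)}\\\theta^{(2)}\end{pmatrix}+\mathbf{\Sigma}^{1/2}\boldsymbol{\varepsilon}(t),\qquad t\in[a,b],$$ with $\theta^{(i)}\in\mathbb{R}^{p_i}$, $\boldsymbol{\varepsilon}=(\varepsilon_1,\varepsilon_2)^\top$ a vector of two independent Brownian motions on $[a,b]$, and $\mathbf{\Sigma}=\begin{pmatrix}\sigma_1^2&\sigma_1\sigma_2\varrho\\ \sigma_1\sigma_2\varrho&\sigma_2^2\end{pmatrix}$, $\sigma_1,\sigma_2>0$. Let $\hat\theta^{(\ell)}_{\rm BLUE}$ be the best linear unbiased estimator of $\theta^{(\ell)}$ obtained by simultaneous estimation from both groups, and $\hat\theta^{(\ell)}_{\rm mar}$ the best linear unbiased estimator of $\theta^{(\ell)}$ obtained by separate estimation from the $\ell$-th group only. Then, with respect to the Loewner ordering, $$\mathrm{Cov}(\hat\theta^{(\ell)}_{\rm BLUE})\le\mathrm{Cov}(\hat\theta^{(\ell)}_{\rm mar}),\qquad \ell=1,2,$$ for all $\varrho\in(-1,1)$.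
   Context: The Brownian motions on $[a,b]$ are centered continuous Gaussian processes with covariance $\min(s,t)$. $\mathbf{\Sigma}^{1/2}$ is the symmetric square root of $\mathbf{\Sigma}$; a dot denotes differentiation in $t$. Loewner ordering: $A\le B$ iff $B-A$ is nonnegative definite. Simultaneous estimation: with $\mathbf{F}^\top(t)=\begin{pmatrix}f_1^\top(t)&0_{p_2}^\top\\0_{p_1}^\top&f_2^\top(t)\end{pmatrix}$, $\mathbf{Y}=(Y_1,Y_2)^\top$ and $\mathbf{M}=\int_a^b\dot{\mathbf{F}}(t)\mathbf{\Sigma}^{-1}\dot{\mathbf{F}}^\top(t)dt+\frac1a\mathbf{F}(a)\mathbf{\Sigma}^{-1}\mathbf{F}^\top(a)$ (assumed non-singular), the estimator is $$\begin{pmatrix}\hat\theta^{(1)}_{\rm BLUE}\\\hat\theta^{(2)}_{\rm BLUE}\end{pmatrix}=\mathbf{M}^{-1}\Big(\int_a^b\dot{\mathbf{F}}(t)\mathbf{\Sigma}^{-1}d\mathbf{Y}(t)+\frac1a\mathbf{F}(a)\mathbf{\Sigma}^{-1}\mathbf{Y}(a)\Big),$$ where $\hat\theta^{(\ell)}_{\rm BLUE}$ is $p_\ell$-dimensional; its covariance matrix is $\mathbf{M}^{-1}$. Separate estimation: for $\ell=1,2$, $$\hat\theta^{(\ell)}_{\rm mar}=\mathbf{M}_{\ell\ell}^{-1}\Big(\int_a^b\dot f_\ell(t)\,dY_\ell(t)+\frac1a f_\ell(a)Y_\ell(a)\Big),\qquad \mathbf{M}_{\ell\ell}=\int_a^b\dot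 f_\ell(t)\dot f_\ell^\top(t)dt+\frac1a f_\ell(a)f_\ell^\top(a),$$ with covariance matrix $\sigma_\ell^2\mathbf{M}_{\ell\ell}^{-1}$. *)

(* Defs.v *)
From HB Require Import structures.
From mathcomp Require Import all_boot all_order all_algebra.
From mathcomp Require Import all_classical all_reals all_analysis.
Set Implicit Arguments.
Unset Strict Implicit.
Unset Printing Implicit Defensive.
Import Order.TTheory GRing.Theory Num.Theory.
Import numFieldNormedType.Exports.
Local Open Scope classical_set_scope.
Local Open Scope ring_scope.

Definition nonneg_definite (R : realType) (n : nat) (A : 'M[R]_n) : Prop :=
  A^T = A /\ forall x : 'cV[R]_n, 0 <= (x^T *m A *m x) 0 0.

Definition loewner_le (R : realType) (n : nat) (A B : 'M[R]_n) : Prop :=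
  nonneg_definite (B - A).

(* Nonnegative definiteness makes the symmetric square root unique. *)
Definition is_symmetric_sqrt (R : realType) (n : nat) (V S : 'M[R]_n) : Prop :=
  nonneg_definite S /\ S *m S = V.

Definition Sigma_mx (R : realType) (s1 s2 rho : R) : 'M[R]_(1 + 1) :=
  block_mx (s1 ^+ 2)%:M (s1 * s2 * rho)%:M
           (s1 * s2 * rho)%:M (s2 ^+ 2)%:M.

(* Only the values of g on [a, b] matter: the difference quotient is taken
   along points of [a, b], so the derivative is one-sided at a and at b. *)
Definition itv_quotient (R : realType) (a b : R) (g : R -> R) (t : R) :=
  (fun s => (g s - g t) / (s - t)) @ within (`[a, b] `\ t) (nbhs t).

Definition itv_deriv (R : realType) (a b : R) (g : R -> R) (t : R) : R :=
  lim (itv_quotient a b g t).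

Definition C1_itv (R : realType) (a b : R) (g : R -> R) : Prop :=
  (forall t, t \in `[a, b] -> cvg (itv_quotient a b g t)) /\
  {within `[a, b], continuous (itv_deriv a b g)}.

Definition mx_deriv (R : realType) (a b : R) (m n : nat)
    (F : R -> 'M[R]_(m, n)) (t : R) : 'M[R]_(m, n) :=
  \matrix_(i, j) itv_deriv a b (fun s => F s i j) t.

Definition mx_integral (R : realType) (a b : R) (m n : nat)
    (F : R -> 'M[R]_(m, n)) : 'M[R]_(m, n) :=
  \matrix_(i, j) \int[lebesgue_measure]_(t in `[a, b]) F t i j.

Definition C1_vec (R : realType) (a b : R) (p : nat) (f : R -> 'cV[R]_p) :=
  forall i, C1_itv a b (fun t => f t i 0).

Definition lin_indep_components (R : realType) (a b : R) (p : nat)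
    (f : R -> 'cV[R]_p) : Prop :=
  forall c : 'cV[R]_p, (forall t, t \in `[a, b] -> c^T *m f t = 0) -> c = 0.

(* Point masses are the degenerate Gaussian laws; they are separated out since
   [normal_prob m 0] is not a point mass in the library. *)
Definition gaussian (R : realType) (d : measure_display)
    (T : measurableType d) (P : probability T R) (X : T -> R) : Prop :=
  measurable_fun setT X /\
  ((exists m s : R, s != 0 /\
      forall A : set R, measurable A -> P (X @^-1` A) = normal_prob m s A) \/
   (exists m : R,
      forall A : set R, measurable A -> P (X @^-1` A) = dirac m A)).

Definition gaussian_process (R : realType) (d : measure_display)
    (T : measurableType d) (P : probability T R) (a b : R)
    (W : R -> T -> R) : Prop :=
  forall (n : nat) (t c : 'I_n -> R), (forall i, t i \in `[a, b]) ->
    gaussian P (fun w => \sum_(i < n) c i * W (t i) w).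

Definition brownian_motion (R : realType) (d : measure_display)
    (T : measurableType d) (P : probability T R) (a b : R)
    (W : R -> T -> R) : Prop :=
  [/\ gaussian_process P a b W,
      forall t, t \in `[a, b] -> ('E_P[W t] = 0)%E,
      forall s t, s \in `[a, b] -> t \in `[a, b] ->
        covariance P (W s) (W t) = (Num.min s t)%:E
    & {ae P, forall w, {within `[a, b], continuous (fun t => W t w)}}].

Definition process_sigma_algebra (R : realType) (d : measure_display)
    (T : measurableType d) (a b : R) (W : R -> T -> R) : set (set T) :=
  <<s \bigcup_(t in `[a, b])
        preimage_set_system setT (W t) (measurable : set (set R)) >>.

Definition independent_processes (R : realType) (d : measure_display)
    (T : measurableType d) (P : probability T R) (a b : R)
    (W1 W2 : R -> T -> R) : Prop :=
  forall A B : set T,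
    process_sigma_algebra a b W1 A -> process_sigma_algebra a b W2 B ->
    P (A `&` B) = (P A * P B)%E.

(* A partition a < s_0 < ... < s_(n-1) = b is represented as in
   [itv_partition]: the left end point a is not listed in s. *)
Definition stoch_riemann_sum (R : realType) (T : Type) (a : R) (m n : nat)
    (G : R -> 'M[R]_(m, n)) (Y : R -> T -> 'cV[R]_n) (s : seq R) (w : T)
    : 'cV[R]_m :=
  \sum_(k < size s)
    G (nth a (a :: s) k) *m (Y (nth a s k) w - Y (nth a (a :: s) k) w).

Definition mesh_lt (R : realType) (a : R) (s : seq R) (delta : R) : Prop :=
  forall k, (k < size s)%N -> nth a s k - nth a (a :: s) k < delta.

(* I is (a version of) \int_a^b G(t) dY(t): the mean-square limit of the
   Riemann sums as the mesh tends to 0, which determines I almost surely.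
   The integrands used below are continuous on [a, b], and for these the
   mean-square limit coincides with the Wiener integral. *)
Definition is_stoch_integral (R : realType) (d : measure_display)
    (T : measurableType d) (P : probability T R) (a b : R) (m n : nat)
    (G : R -> 'M[R]_(m, n)) (Y : R -> T -> 'cV[R]_n) (I : T -> 'cV[R]_m)
    : Prop :=
  (forall i, measurable_fun setT (fun w => I w i 0)) /\
  forall e : R, 0 < e -> exists2 delta : R, 0 < delta &
    forall s : seq R, itv_partition a b s -> mesh_lt a s delta ->
      forall i,
        ('E_P[fun w => (((I w - stoch_riemann_sum a G Y s w) i 0) ^+ 2)%R]
           <= e%:E)%E.

Definition cov_mx (R : realType) (d : measure_display)
    (T : measurableType d) (P : probability T R) (p : nat)
    (Z : T -> 'cV[R]_p) : 'M[R]_p :=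
  \matrix_(i, j)
    fine (covariance P (fun w => Z w i 0) (fun w => Z w j 0)).

Definition design_mx (R : realType) (p1 p2 : nat)
    (f1 : R -> 'cV[R]_p1) (f2 : R -> 'cV[R]_p2) (t : R)
    : 'M[R]_(p1 + p2, 1 + 1) :=
  (block_mx (f1 t)^T 0 0 (f2 t)^T)^T.

Definition response (R : realType) (T : Type) (p1 p2 : nat)
    (f1 : R -> 'cV[R]_p1) (f2 : R -> 'cV[R]_p2)
    (theta1 : 'cV[R]_p1) (theta2 : 'cV[R]_p2) (S : 'M[R]_(1 + 1))
    (eps1 eps2 : R -> T -> R) (t : R) (w : T) : 'cV[R]_(1 + 1) :=
  (design_mx f1 f2 t)^T *m col_mx theta1 theta2
  + S *m col_mx (eps1 t w)%:M (eps2 t w)%:M.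

Definition blue_mx (R : realType) (a b : R) (p q : nat)
    (F : R -> 'M[R]_(p, q)) (V : 'M[R]_q) : 'M[R]_p :=
  mx_integral a b
    (fun t => mx_deriv a b F t *m invmx V *m (mx_deriv a b F t)^T)
  + a^-1 *: (F a *m invmx V *m (F a)^T).

(* I stands for \int_a^b F'(t) V^-1 dY(t). *)
Definition blue (R : realType) (T : Type) (a b : R) (p q : nat)
    (F : R -> 'M[R]_(p, q)) (V : 'M[R]_q) (Y : R -> T -> 'cV[R]_q)
    (I : T -> 'cV[R]_p) (w : T) : 'cV[R]_p :=
  invmx (blue_mx a b F V) *m (I w + a^-1 *: (F a *m invmx V *m Y a w)).

Definition mar_mx (R : realType) (a b : R) (p : nat)
    (f : R -> 'cV[R]_p) : 'M[R]_p :=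
  mx_integral a b (fun t => mx_deriv a b f t *m (mx_deriv a b f t)^T)
  + a^-1 *: (f a *m (f a)^T).

(* I stands for \int_a^b f'(t) dy(t), with y the response of a single group. *)
Definition mar (R : realType) (T : Type) (a b : R) (p : nat)
    (f : R -> 'cV[R]_p) (y : R -> T -> 'cV[R]_1) (I : T -> 'cV[R]_p) (w : T)
    : 'cV[R]_p :=
  invmx (mar_mx a b f) *m (I w + a^-1 *: (f a *m y a w)).

(* Main.v *)
Require Import Defs.
From HB Require Import structures.
From mathcomp Require Import all_boot all_order all_algebra.
From mathcomp Require Import all_classical all_reals all_analysis.
From mathcomp Require Import measurable_realfun.
From mathcomp Require Import ring lra.
Set Implicit Arguments.
Unset Strict Implicit.
Unset Printing Implicit Defensive.
Import Order.TTheory GRing.Theory Num.Theory.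
Import numFieldNormedType.Exports.
Local Open Scope classical_set_scope.
Local Open Scope ring_scope.

(** Each estimator is the inverse of an information matrix times a random
vector, its score: the joint estimator is [M^-1 N] and the separate estimator of
one group is [M1^-1 N1].

The argument rests on second moments.  Since the square root of Sigma is
symmetric and the two Brownian motions are uncorrelated, the covariance matrix
of [Y s] and [Y t] is [min(s, t) Sigma].  Hence increments
over disjoint intervals are uncorrelated with each other and with the past, the
covariance matrix of two Riemann sums over one partition is a Riemann sum, and
in the mean-square limit one gets the isometry
  Cov (int G dY + A Y(a), int H dY + B Y(a))
    = int G Sigma H^T + a A Sigma B^T
([ccov_integral_add_initial]).  It gives [Cov (N, N) = M].

The comparison is then the Gauss-Markov argument.  Let E and e be the matrices
that select one group among the parameters and among the responses.  The block
shape of the design gives [e F^T = f^T E], and the isometry then gives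
[Cov (N1, N) = M1 E]: the factor Sigma meets its inverse and cancels.
Therefore the separate estimator and the corresponding block of the joint
estimator have cross-covariance [M1^-1 M1 E M^-1 E^T = E M^-1 E^T], which is
the covariance matrix of that block.  The separate estimator minus the block of
the joint one is thus uncorrelated with the latter, so the difference of the
two covariance matrices is the covariance matrix of a random vector, hence
nonnegative definite ([blue_loewner_le_mar]).  Neither the inverse of a block
matrix nor the covariance of the separate estimator has to be computed.

The remaining point is that M1 is invertible.  This follows from the
invertibility of M, because the block [E M E^T] of the positive definite matrix
M is a multiple of M1 ([blue_mx_block], [mar_mx_unit]). *)

(** * Covariance of square integrable variables *)

Section SquareIntegrable.
Context (R : realType) (d : measure_display) (T : measurableType d).
Variable P : probability T R.
Implicit Types X Y Z : T -> R.
Local Notation L2 := (Lfun P 2%:E).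

Lemma L2_L1 X : X \in L2 -> X \in Lfun P 1.
Proof.
by move=> X2; apply: (Lfun_subset12 (fin_num_measure P _ measurableT)).
Qed.

Lemma L2_measurable X : X \in L2 -> measurable_fun setT X.
Proof. by rewrite inE => /andP[]; rewrite inE. Qed.

Lemma L2_add X Y : X \in L2 -> Y \in L2 -> (fun w => X w + Y w) \in L2.
Proof.
move=> X2 Y2; rewrite -[fun w => _]/(X + Y).
by apply: rpredD => //; rewrite lee1n.
Qed.

Lemma L2_scale (c : R) X : X \in L2 -> (fun w => c * X w) \in L2.
Proof.
move=> X2; have -> : (fun w => c * X w) = c \o* X.
  by apply/funext => w /=; rewrite mulrC.
by apply: Lfun_scale; rewrite ?ler1n.
Qed.

Lemma L2_sub X Y : X \in L2 -> Y \in L2 -> (fun w => X w - Y w) \in L2.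
Proof.
move=> X2 Y2; have -> : (fun w => X w - Y w) = (fun w => X w + (-1) * Y w).
  by apply/funext => w; rewrite mulN1r.
exact/L2_add/L2_scale.
Qed.

Lemma L2_cst (c : R) : (fun _ : T => c) \in L2.
Proof. exact: Lfun_cst. Qed.

Lemma L2_sum (n : nat) (X : 'I_n -> T -> R) :
  (forall k, X k \in L2) -> (fun w => \sum_k X k w) \in L2.
Proof.
move=> X2; elim: n X X2 => [|n IHn] X X2.
  by under eq_fun do rewrite big_ord0; exact: L2_cst.
by under eq_fun do rewrite big_ord_recl; apply: L2_add => //; exact: IHn.
Qed.

Lemma sqr_integrable_L2 X : measurable_fun setT X ->
  ('E_P[fun w => (X w ^+ 2)%R] < +oo)%E -> X \in L2.
Proof.
move=> mX fX; rewrite inE; apply/andP; split; rewrite inE//=.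
rewrite /finite_norm unlock /Lnorm poweR_lty//.
move: fX; rewrite unlock; apply: le_lt_trans.
by under eq_integral => w _ do rewrite /= powR_mulrn// real_normK ?num_real//.
Qed.

(** Real-valued covariance; it is meaningful for square integrable variables,
where the extended-real covariance is finite. *)
Definition rcov X Y : R := fine (covariance P X Y).

Lemma rcovC X Y : rcov X Y = rcov Y X.
Proof. by rewrite /rcov covarianceC. Qed.

Lemma L2_cov_fin X Y : X \in L2 -> Y \in L2 -> covariance P X Y \is a fin_num.
Proof.
move=> X2 Y2; apply: covariance_fin_num; [exact: L2_L1|exact: L2_L1|].
exact: Lfun2_mul_Lfun1.
Qed.

Lemma rcovDl X Y Z : X \in L2 -> Y \in L2 -> Z \in L2 ->
  rcov (fun w => X w + Y w) Z = rcov X Z + rcov Y Z.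
Proof.
by move=> X2 Y2 Z2; rewrite /rcov covarianceDl// fineD// L2_cov_fin.
Qed.

Lemma rcovZl (c : R) X Z : X \in L2 -> Z \in L2 ->
  rcov (fun w => c * X w) Z = c * rcov X Z.
Proof.
move=> X2 Z2; rewrite /rcov.
have -> : (fun w => c * X w) = c \o* X.
  by apply/funext => w /=; rewrite mulrC.
rewrite covarianceZl; [|exact: L2_L1|exact: L2_L1|exact: Lfun2_mul_Lfun1].
by rewrite fineM// L2_cov_fin.
Qed.

Lemma rcovBl X Y Z : X \in L2 -> Y \in L2 -> Z \in L2 ->
  rcov (fun w => X w - Y w) Z = rcov X Z - rcov Y Z.
Proof.
by move=> X2 Y2 Z2; rewrite /rcov covarianceBl// fineB// L2_cov_fin.
Qed.

Lemma rcovBr X Y Z : X \in L2 -> Y \in L2 -> Z \in L2 ->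
  rcov Z (fun w => X w - Y w) = rcov Z X - rcov Z Y.
Proof. by move=> *; rewrite !(rcovC Z) rcovBl. Qed.

Lemma rcov_cstl (c : R) Z : rcov (fun _ => c) Z = 0.
Proof. by rewrite /rcov covariance_cst_l. Qed.

Lemma rcov_suml (n : nat) (X : 'I_n -> T -> R) Z :
  (forall k, X k \in L2) -> Z \in L2 ->
  rcov (fun w => \sum_k X k w) Z = \sum_k rcov (X k) Z.
Proof.
move=> X2 Z2; elim: n X X2 => [|n IHn] X X2.
  by under eq_fun do rewrite big_ord0; rewrite big_ord0 rcov_cstl.
under eq_fun do rewrite big_ord_recl.
by rewrite rcovDl//; [rewrite big_ord_recl IHn | exact: L2_sum].
Qed.

Lemma rcov_ge0 X : 0 <= rcov X X.
Proof. by rewrite fine_ge0// variance_ge0. Qed.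

Lemma rcov_le_expectation_sqr X (c : R) : X \in L2 ->
  ('E_P[fun w => (X w ^+ 2)%R] <= c%:E)%E -> rcov X X <= c.
Proof.
move=> X2 Xc; rewrite -lee_fin fineK ?L2_cov_fin//.
apply: le_trans Xc; rewrite -/(variance P X) varianceE//.
rewrite leeBlDr; last by rewrite fin_numX// expectation_fin_num// L2_L1.
by apply: leeDl; exact: sqre_ge0.
Qed.

Lemma rcov_cauchy_schwarz X Y : X \in L2 -> Y \in L2 ->
  `|rcov X Y| <= Num.sqrt (rcov X X) * Num.sqrt (rcov Y Y).
Proof.
have main U W : U \in L2 -> W \in L2 ->
    rcov U W <= Num.sqrt (rcov U U) * Num.sqrt (rcov W W).
  move=> U2 W2; rewrite -lee_fin fineK ?L2_cov_fin//.
  apply: le_trans (covariance_le U2 W2) _.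
  by rewrite /variance -(fineK (L2_cov_fin U2 U2)) -(fineK (L2_cov_fin W2 W2)).
move=> X2 Y2; rewrite ler_norml main// andbT lerNl.
have NX2 := L2_scale (-1) X2.
have := main _ _ NX2 Y2; set N := fun w => -1 * X w in NX2 *.
have -> : rcov N N = rcov X X.
  by rewrite rcovZl// rcovC rcovZl// mulrA mulN1r opprK mul1r.
by rewrite rcovZl// mulN1r.
Qed.

(** Continuity of the covariance for mean-square distance, with an explicit
modulus.  It follows from the Cauchy-Schwarz inequality applied to each term of
[cov X Y - cov X' Y'
  = cov (X - X') Y + cov X (Y - Y') - cov (X - X') (Y - Y')]. *)
Lemma rcov_approx X Y X' Y' (r : R) : 0 < r ->
  X \in L2 -> Y \in L2 -> X' \in L2 -> Y' \in L2 ->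
  ('E_P[fun w => ((X w - X' w) ^+ 2)%R] <= (r ^+ 2)%:E)%E ->
  ('E_P[fun w => ((Y w - Y' w) ^+ 2)%R] <= (r ^+ 2)%:E)%E ->
  `|rcov X Y - rcov X' Y'| <=
    r * (r + Num.sqrt (rcov X X) + Num.sqrt (rcov Y Y)).
Proof.
move=> r0 X2 Y2 X'2 Y'2 EX EY.
have U2 := L2_sub X2 X'2; have W2 := L2_sub Y2 Y'2.
have sqrt_le Z : Z \in L2 -> ('E_P[fun w => (Z w ^+ 2)%R] <= (r ^+ 2)%:E)%E ->
    Num.sqrt (rcov Z Z) <= r.
  move=> Z2 /(rcov_le_expectation_sqr Z2) Zr.
  by rewrite -[leRHS]gtr0_norm// -sqrtr_sqr ler_wsqrtr.
have {EX} Ur := sqrt_le _ U2 EX; have {EY} Wr := sqrt_le _ W2 EY.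
set U := fun w => X w - X' w in U2 Ur; set W := fun w => Y w - Y' w in W2 Wr.
have -> : rcov X Y - rcov X' Y' = rcov U Y + rcov X W - rcov U W.
  rewrite (rcovBr Y2 Y'2 U2) (rcovBr Y2 Y'2 X2).
  by rewrite (rcovBl X2 X'2 Y2) (rcovBl X2 X'2 Y'2); ring.
have CS A B := rcov_cauchy_schwarz (X := A) (Y := B).
apply: (@le_trans _ _ (`|rcov U Y| + `|rcov X W| + `|rcov U W|)).
  by apply: le_trans (ler_normB _ _) _; rewrite lerD2r ler_normD.
have rU := CS _ _ U2 Y2; have rW := CS _ _ X2 W2; have rUW := CS _ _ U2 W2.
set x := Num.sqrt (rcov X X) in rW *; set y := Num.sqrt (rcov Y Y) in rU *.
set u := Num.sqrt (rcov U U) in Ur rU rUW.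
set v := Num.sqrt (rcov W W) in Wr rW rUW.
have [x0 y0 u0 v0] : [/\ 0 <= x, 0 <= y, 0 <= u & 0 <= v].
  by split; exact: sqrtr_ge0.
nra.
Qed.

(** A covariance may be computed along mean-square approximations; this is how
stochastic integrals are reached from their Riemann sums. *)
Lemma rcov_limit X Z (c : R) : X \in L2 -> Z \in L2 ->
  (forall r, 0 < r -> exists X' Z',
    [/\ X' \in L2, Z' \in L2,
      ('E_P[fun w => ((X w - X' w) ^+ 2)%R] <= (r ^+ 2)%:E)%E,
      ('E_P[fun w => ((Z w - Z' w) ^+ 2)%R] <= (r ^+ 2)%:E)%E
      & `|rcov X' Z' - c| <= r]) ->
  rcov X Z = c.
Proof.
move=> X2 Z2 approx; apply/eqP; rewrite -subr_eq0 -normr_le0.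
apply/ler_addgt0Pr => e e0; rewrite add0r.
set K := 2 + Num.sqrt (rcov X X) + Num.sqrt (rcov Z Z).
have K0 : 0 < K by rewrite /K -addrA ltr_pwDl// addr_ge0 ?sqrtr_ge0.
(* For [r <= 1], the bound of [rcov_approx] plus [r] is at most [r * K]. *)
pose r := Num.min 1 (e / K).
have r0 : 0 < r by rewrite lt_min ltr01 divr_gt0.
have [X' [Z' [X'2 Z'2 XX' ZZ' X'Z'c]]] := approx r r0.
have := rcov_approx r0 X2 Z2 X'2 Z'2 XX' ZZ'.
have rK : r * K <= e by rewrite -ler_pdivlMr// ge_min lexx orbT.
have r1 : r <= 1 by rewrite ge_min lexx.
rewrite -(subrKA (rcov X' Z')) => XZ; apply: le_trans rK.
apply: le_trans (ler_normD _ _) _; apply: le_trans (lerD XZ X'Z'c) _.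
by rewrite -[X in _ + X]mulr1 -mulrDr ler_pM2l// /K; lra.
Qed.

End SquareIntegrable.

Section CrossCovariance.
Context (R : realType) (d : measure_display) (T : measurableType d).
Variable P : probability T R.

Definition L2v (n : nat) (Z : T -> 'cV[R]_n) : Prop :=
  forall i, (fun w => Z w i 0) \in Lfun P 2%:E.

Definition ccov (m n : nat) (X : T -> 'cV[R]_m) (Z : T -> 'cV[R]_n)
    : 'M[R]_(m, n) :=
  \matrix_(i, j) rcov P (fun w => X w i 0) (fun w => Z w j 0).

Lemma L2v_add n (X Z : T -> 'cV[R]_n) :
  L2v X -> L2v Z -> L2v (fun w => X w + Z w).
Proof.
by move=> X2 Z2 i; under eq_fun do rewrite mxE; exact: L2_add.
Qed.

Lemma L2v_sub n (X Z : T -> 'cV[R]_n) :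
  L2v X -> L2v Z -> L2v (fun w => X w - Z w).
Proof.
by move=> X2 Z2 i; under eq_fun do rewrite !mxE; exact: L2_sub.
Qed.

Lemma L2v_cst n (c : 'cV[R]_n) : L2v (fun=> c).
Proof. by move=> i; exact: L2_cst. Qed.

Lemma L2v_mul m n (A : 'M[R]_(m, n)) (X : T -> 'cV[R]_n) :
  L2v X -> L2v (fun w => A *m X w).
Proof.
move=> X2 i; under eq_fun do rewrite mxE.
by apply: L2_sum => k; exact: L2_scale.
Qed.

Lemma tr_ccov m n (X : T -> 'cV[R]_m) (Z : T -> 'cV[R]_n) :
  (ccov X Z)^T = ccov Z X.
Proof. by apply/matrixP => i j; rewrite !mxE rcovC. Qed.

Lemma ccovDl m n (X Y : T -> 'cV[R]_m) (Z : T -> 'cV[R]_n) :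
  L2v X -> L2v Y -> L2v Z ->
  ccov (fun w => X w + Y w) Z = ccov X Z + ccov Y Z.
Proof.
move=> X2 Y2 Z2; apply/matrixP => i j; rewrite !mxE -rcovDl//.
by congr rcov; apply/funext => w; rewrite mxE.
Qed.

Lemma ccovBl m n (X Y : T -> 'cV[R]_m) (Z : T -> 'cV[R]_n) :
  L2v X -> L2v Y -> L2v Z ->
  ccov (fun w => X w - Y w) Z = ccov X Z - ccov Y Z.
Proof.
move=> X2 Y2 Z2; apply/matrixP => i j; rewrite !mxE -rcovBl//.
by congr rcov; apply/funext => w; rewrite !mxE.
Qed.

Lemma ccovMl p m n (A : 'M[R]_(p, m)) (X : T -> 'cV[R]_m) (Z : T -> 'cV[R]_n) :
  L2v X -> L2v Z -> ccov (fun w => A *m X w) Z = A *m ccov X Z.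
Proof.
move=> X2 Z2; apply/matrixP => i j; rewrite !mxE.
have -> : (fun w => (A *m X w) i 0) = (fun w => \sum_k A i k * X w k 0).
  by apply/funext => w; rewrite mxE.
rewrite rcov_suml//; last by move=> k; exact: L2_scale.
by apply: eq_bigr => k _; rewrite rcovZl// mxE.
Qed.

Lemma ccov_cstl m n (c : 'cV[R]_m) (Z : T -> 'cV[R]_n) : ccov (fun=> c) Z = 0.
Proof. by apply/matrixP => i j; rewrite !mxE rcov_cstl. Qed.

Lemma ccovDr m n (X Y : T -> 'cV[R]_m) (Z : T -> 'cV[R]_n) :
  L2v X -> L2v Y -> L2v Z ->
  ccov Z (fun w => X w + Y w) = ccov Z X + ccov Z Y.
Proof. by move=> *; rewrite -tr_ccov ccovDl// linearD/= !tr_ccov. Qed.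

Lemma ccovBr m n (X Y : T -> 'cV[R]_m) (Z : T -> 'cV[R]_n) :
  L2v X -> L2v Y -> L2v Z ->
  ccov Z (fun w => X w - Y w) = ccov Z X - ccov Z Y.
Proof. by move=> *; rewrite -tr_ccov ccovBl// linearB/= !tr_ccov. Qed.

Lemma ccovMr p m n (A : 'M[R]_(p, m)) (X : T -> 'cV[R]_m) (Z : T -> 'cV[R]_n) :
  L2v X -> L2v Z -> ccov Z (fun w => A *m X w) = ccov Z X *m A^T.
Proof. by move=> *; rewrite -tr_ccov ccovMl// trmx_mul tr_ccov. Qed.

Lemma ccov_cstr m n (c : 'cV[R]_m) (Z : T -> 'cV[R]_n) : ccov Z (fun=> c) = 0.
Proof. by rewrite -tr_ccov ccov_cstl trmx0. Qed.

Lemma ccov_nonneg_definite n (X : T -> 'cV[R]_n) :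
  L2v X -> nonneg_definite (ccov X X).
Proof.
move=> X2; split=> [|x]; first exact: tr_ccov.
have -> : x^T *m ccov X X *m x =
    ccov (fun w => x^T *m X w) (fun w => x^T *m X w).
  by rewrite ccovMl ?ccovMr ?trmxK ?mulmxA//; exact: L2v_mul.
by rewrite mxE rcov_ge0.
Qed.

End CrossCovariance.

(** * Independence and Brownian motion *)

Section Independence.
Context (R : realType) (d : measure_display) (T : measurableType d).
Variable P : probability T R.
Local Open Scope ereal_scope.

(** By uniqueness of the product measure, the joint law of two independent
variables is the product of their laws, and Fubini's theorem splits the integral
of the product of the coordinates. *)
Lemma independent_expectationM (X Y : T -> R) :
  X \in Lfun P 2%:E -> Y \in Lfun P 2%:E ->
  (forall A B : set R, measurable A -> measurable B ->
    P (X @^-1` A `&` Y @^-1` B) = P (X @^-1` A) * P (Y @^-1` B)) ->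
  'E_P[(X \* Y)%R] = 'E_P[X] * 'E_P[Y].
Proof.
move=> X2 Y2 XY.
have mX := L2_measurable X2; have mY := L2_measurable Y2.
have iX : P.-integrable setT (EFin \o X) by apply/Lfun1_integrable/L2_L1.
have iY : P.-integrable setT (EFin \o Y) by apply/Lfun1_integrable/L2_L1.
have iXY : P.-integrable setT (EFin \o (X \* Y)%R).
  by apply/Lfun1_integrable; exact: Lfun2_mul_Lfun1.
pose Xm : {mfun T >-> R} := HB.pack X (isMeasurableFun.Build _ _ _ _ _ mX).
pose Ym : {mfun T >-> R} := HB.pack Y (isMeasurableFun.Build _ _ _ _ _ mY).
pose Z w := (X w, Y w).
have mZ : measurable_fun setT Z by exact: measurable_fun_pair.
pose Zm : {mfun T >-> (R * R)%type} :=
  HB.pack Z (isMeasurableFun.Build _ _ _ _ _ mZ).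
pose PX := distribution P Xm; pose PY := distribution P Ym.
pose f (z : R * R) := (z.1 * z.2)%:E.
have mf : measurable_fun setT f.
  by apply/measurable_EFinP; exact: measurable_funM.
have prodE A : measurable A -> (PX \x PY) A = distribution P Zm A.
  apply: product_measure_unique => B C mB mC.
  by rewrite -[RHS]XY.
have iPY : \int[PY]_y y%:E = 'E_P[Y].
  by rewrite integral_distribution// unlock.
have jPY : PY.-integrable setT (EFin : R -> \bar R).
  by apply: integrable_pushforward => //; exact/measurable_EFinP.
have jf : (PX \x PY).-integrable setT f.
  have /integrableP[_ f_fin] : (distribution P Zm).-integrable setT f.
    exact: integrable_pushforward.
  apply/integrableP; split=> //; apply: le_lt_trans f_fin.
  by rewrite (eq_measure_integral (distribution P Zm))// => A mA _; exact: prodE.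
have EY : 'E_P[Y] = (fine 'E_P[Y])%:E.
  by rewrite fineK// expectation_fin_num// L2_L1.
transitivity (\int[distribution P Zm]_z f z).
  by rewrite integral_distribution// unlock.
transitivity (\int[PX \x PY]_z f z).
  by apply: eq_measure_integral => A mA _; exact/esym/prodE.
rewrite -integral12_prod_meas1//.
transitivity (\int[PX]_x (x%:E * 'E_P[Y])).
  by apply: eq_integral => x _; rewrite /fubini_F/= -iPY -integralZl//.
rewrite EY integralZr//; last first.
  by apply: integrable_pushforward => //; exact/measurable_EFinP.
by rewrite integral_distribution// unlock.
Qed.
End Independence.

Section Brownian.
Context (R : realType) (d : measure_display) (T : measurableType d).
Variables (P : probability T R) (a b : R).

Lemma independent_processes_uncorrelated (W1 W2 : R -> T -> R) s t :
  independent_processes P a b W1 W2 -> s \in `[a, b] -> t \in `[a, b] ->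
  W1 s \in Lfun P 2%:E -> W2 t \in Lfun P 2%:E -> rcov P (W1 s) (W2 t) = 0.
Proof.
move=> ind sab tab W1s W2t.
rewrite /rcov covarianceE; [|exact: L2_L1|exact: L2_L1|exact: Lfun2_mul_Lfun1].
rewrite (independent_expectationM W1s W2t).
  by rewrite subee// fin_numM// expectation_fin_num// L2_L1.
have gen (W : R -> T -> R) u C : u \in `[a, b] -> measurable C ->
    process_sigma_algebra a b W (W u @^-1` C).
  move=> uab mC; apply: sub_sigma_algebra; exists u => //.
  by exists C => //; rewrite setTI.
by move=> A B mA mB; apply: ind; exact: gen.
Qed.

(** The finite variance [Cov (W t, W t) = t] gives square integrability, and
measurability is part of the Gaussian property. *)
Lemma brownian_L2 (W : R -> T -> R) t :
  brownian_motion P a b W -> t \in `[a, b] -> W t \in Lfun P 2%:E.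
Proof.
move=> [gW EW covW _] tab.
have mW : measurable_fun setT (W t).
  have [+ _] := gW 1%N (fun=> t) (fun=> 1) (fun=> tab).
  by under eq_fun do rewrite big_ord1 mul1r.
apply: sqr_integrable_L2 => //.
have := covW t t tab tab; rewrite unlock EW//= => {}covW.
rewrite [X in (X < _)%E](_ : _ = (Num.min t t)%:E) ?ltry// -covW.
congr expectation; apply/funext => w.
by rewrite -[RHS]/((W t w - 0) * (W t w - 0)) subr0 expr2.
Qed.

Lemma brownian_rcov (W : R -> T -> R) s t :
  brownian_motion P a b W -> s \in `[a, b] -> t \in `[a, b] ->
  rcov P (W s) (W t) = Num.min s t.
Proof. by move=> [_ _ covW _] sab tab; rewrite /rcov covW. Qed.

Lemma ccov_brownian_pair (W1 W2 : R -> T -> R) s t :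
  brownian_motion P a b W1 -> brownian_motion P a b W2 ->
  independent_processes P a b W1 W2 -> s \in `[a, b] -> t \in `[a, b] ->
  let W u w : 'cV[R]_(1 + 1) := col_mx (W1 u w)%:M (W2 u w)%:M in
  L2v P (W s) /\ ccov P (W s) (W t) = (Num.min s t)%:M.
Proof.
move=> B1 B2 ind sab tab W.
have WE u (i : 'I_1) : ((fun w => W u w (lshift 1 i) 0) = W1 u) *
    ((fun w => W u w (rshift 1 i) 0) = W2 u).
  by split; apply/funext => w; rewrite /W ?col_mxEu ?col_mxEd mxE ord1.
split.
  by move=> i; case: (split_ordP i) => k ->; rewrite WE; exact: brownian_L2.
apply/matrixP => i j; rewrite !mxE.
case: (split_ordP i) => {}i ->; case: (split_ordP j) => {}j ->; rewrite !WE.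
- by rewrite brownian_rcov// !ord1 eqxx.
- rewrite (independent_processes_uncorrelated ind)//; try exact: brownian_L2.
  by rewrite eq_lrshift.
- rewrite rcovC (independent_processes_uncorrelated ind)//; try exact: brownian_L2.
  by rewrite eq_rlshift.
- by rewrite brownian_rcov// !ord1 eqxx.
Qed.

End Brownian.

(** * Riemann sums of continuous functions *)

Section PartitionSums.
Context (R : realType).

(** A common form for stochastic and ordinary Riemann sums: [phi] is applied to
the consecutive points of the partition [x :: s].  It satisfies a recursion that
drops the first subinterval, so that all facts about such sums are proved by
induction with a moving left end point. *)
Definition partition_sum (V : zmodType) (phi : R -> R -> V) (x : R) (s : seq R)
    : V :=
  \sum_(k < size s) phi (nth x (x :: s) k) (nth x s k).

Lemma partition_sum_nil (V : zmodType) (phi : R -> R -> V) x :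
  partition_sum phi x [::] = 0.
Proof. by rewrite /partition_sum big_ord0. Qed.

Lemma partition_sum_cons (V : zmodType) (phi : R -> R -> V) x y s :
  partition_sum phi x (y :: s) = phi x y + partition_sum phi y s.
Proof.
rewrite /partition_sum big_ord_recl; congr (_ + _); apply: eq_bigr => k _.
(* The defaults [x] and [y] differ, but all indices are in range. *)
have ks := ltn_ord k; rewrite /= add0n [nth x s k](set_nth_default y)//.
by rewrite [nth x _ k](set_nth_default y)//= leqW.
Qed.

Lemma mesh_lt_cons (x y : R) s delta :
  mesh_lt x (y :: s) delta -> y - x < delta /\ mesh_lt y s delta.
Proof.
move=> m; split=> [|k ks]; first exact: (m 0%N).
have := m k.+1 ks; rewrite /=.
by rewrite (set_nth_default y)// [nth x _ _](set_nth_default y)//= leqW.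
Qed.

Lemma itv_partition_consE (x y b : R) s : itv_partition x b (y :: s) ->
  [/\ x < y, y <= b & itv_partition y b s].
Proof.
move=> xyb; have ysb := itv_partition_cons xyb.
by case: (xyb) => /= /andP[xy _] _; split=> //; exact: itv_partition_le ysb.
Qed.

(** Steps of length [delta / 2] are cut off from the left as long as the
remaining length is at least [delta]. *)
Lemma exists_fine_partition (a b delta : R) : a < b -> 0 < delta ->
  exists2 s, itv_partition a b s & mesh_lt a s delta.
Proof.
move=> ab d0; pose h := delta / 2.
have h0 : 0 < h by rewrite divr_gt0.
have [n] : exists n : nat, b - a < n%:R * h.
  exists (Num.truncn ((b - a) / h)).+1.
  by rewrite -ltr_pdivrMr// truncnS_gt.
elim: n a ab => [|n IHn] a ab.
  by rewrite mul0r subr_lt0 ltNge ltW.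
rewrite -natr1 mulrDl mul1r => ban.
have [bd|db] := ltP (b - a) delta.
  by exists [:: b]; [exact: itv_partition1|case].
have hd : delta = h + h by rewrite /h -splitr.
have [||s ps ms] := IHn (a + h); [lra|lra|].
exists (a + h :: s); first by case: ps => ps1 ps2; split=> //=; rewrite ltrDl h0.
case=> [|k] ks /=; first by rewrite addrAC subrr add0r hd ltrDl.
rewrite (set_nth_default (a + h))//.
by rewrite [nth a _ _](set_nth_default (a + h))//= ?ms// leqW.
Qed.

End PartitionSums.

Section RiemannSums.
Context (R : realType).
Variables (a b : R).
Hypothesis ab : a < b.
Variable g : R -> R.
Hypothesis cg : {within `[a, b], continuous g}.
Local Notation mu := (@lebesgue_measure R).

(** Heine's theorem, from the covering formulation of the compactness of the
segment. *)
Lemma within_continuous_uniform (e : R) : 0 < e ->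
  exists2 delta : R, 0 < delta & forall x y, x \in `[a, b] -> y \in `[a, b] ->
    `|x - y| < delta -> `|g x - g y| < e.
Proof.
move=> e0.
pose Q (i : R) (x : R) := forall y, y \in `[a, b] ->
  `|x - y| < i -> `|g x - g y| < e.
have := @segment_compact R a b.
rewrite compact_near_coveringP -near_covering_withinP.
move=> /(_ R (0^'+) Q _) [].
  move=> x xab.
  have := (subspace_continuousP _ _).1 cg x xab.
  move=> /cvgr_dist_lt /(_ (e / 2)) [|eta /= eta0 gx]; first by rewrite divr_gt0.
  exists (ball x (eta / 2), [set i | i < eta / 2]) => /=.
    split; first by apply: nbhsx_ballx; rewrite divr_gt0.
    by apply: nbhs_right_lt; rewrite divr_gt0.
  move=> [x' i] /= [xx' i_eta] x'ab y yab x'y.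
  have xx'e : `|g x - g x'| < e / 2.
    by apply: gx => //; apply: lt_trans xx' _; rewrite gtr_pMr// invf_lt1 ?ltr1n.
  have xye : `|g x - g y| < e / 2.
    apply: gx => //; rewrite /= (splitr eta) -(subrKA x').
    by apply: le_lt_trans (ler_normD _ _) _; rewrite ltrD// (lt_trans x'y).
  rewrite (splitr e) -(subrKA (g x)).
  by apply: le_lt_trans (ler_normD _ _) _; rewrite ltrD// distrC.
move=> delta /= d0 Qd; exists (delta / 2); first by rewrite divr_gt0.
move=> x y xab yab; apply: Qd => //=; last first.
  by rewrite divr_gt0.
rewrite sub0r normrN ger0_norm ?divr_ge0 ?ltW//.
by rewrite gtr_pMr// invf_lt1 ?ltr1n.
Qed.

Lemma within_continuous_integrable x y : a <= x -> y <= b ->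
  mu.-integrable `[x, y] (EFin \o g).
Proof.
move=> ax yb; apply: continuous_compact_integrable; first exact: segment_compact.
apply: continuous_subspaceW cg.
by apply: subset_itv; rewrite bnd_simp.
Qed.

Lemma Rintegral_itv_split x y : a <= x -> x <= y -> y <= b ->
  \int[mu]_(t in `[x, b]) g t =
  \int[mu]_(t in `[x, y]) g t + \int[mu]_(t in `[y, b]) g t.
Proof.
move=> ax xy yb; have ig := within_continuous_integrable ax (lexx b).
rewrite -[X in _ + X]Rintegral_itv_obnd_cbnd; last first.
  apply: integrableS ig => //.
  by apply: subset_itv; rewrite bnd_simp.
rewrite -(Rintegral_itvB (x := y) ig) ?bnd_simp//.
by rewrite addrC subrK.
Qed.

Lemma Rintegral_near_constant (x y e : R) : a <= x -> x <= y -> y <= b ->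
  (forall t, t \in `[x, y] -> `|g x - g t| <= e) ->
  `|(y - x) * g x - \int[mu]_(t in `[x, y]) g t| <= e * (y - x).
Proof.
move=> ax xy yb gxe; have ig := within_continuous_integrable ax yb.
have ic c : mu.-integrable `[x, y] (EFin \o (fun=> c)).
  apply: continuous_compact_integrable; first exact: segment_compact.
  by apply: continuous_subspaceT => ?; exact: cvg_cst.
have intc c : \int[mu]_(t in `[x, y]) (fun _ : R => c) t = c * (y - x).
  rewrite Rintegral_cst//= lebesgue_measure_itv/= lte_fin.
  by case: ltgtP xy => // -> _; rewrite subrr.
have -> : (y - x) * g x - \int[mu]_(t in `[x, y]) g t =
    \int[mu]_(t in `[x, y]) (g x - g t).
  by rewrite RintegralB// (intc (g x)) mulrC.
rewrite -[e * _](intc e).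
have id : mu.-integrable `[x, y] (EFin \o (fun t => g x - g t)).
  by have := integrableB _ (ic (g x)) ig; apply.
apply: le_trans (le_normr_Rintegral _ id) _ => //.
apply: le_Rintegral => //.
by have := integrable_norm id.
Qed.

(** A modulus of continuity [k = e / (b - a)] bounds the error on each
subinterval by [k] times its length, and these errors add up to [e]. *)
Lemma riemann_sum_cvg (e : R) : 0 < e ->
  exists2 delta : R, 0 < delta &
    forall s, itv_partition a b s -> mesh_lt a s delta ->
      `|partition_sum (fun u v => (v - u) * g u) a s
        - \int[mu]_(t in `[a, b]) g t| <= e.
Proof.
move=> e0; have ba0 : 0 < b - a by rewrite subr_gt0.
have [delta d0 gd] := within_continuous_uniform (divr_gt0 e0 ba0).
exists delta => // s pas mas.
rewrite -[leRHS](divfK (lt0r_neq0 ba0)).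
set k := e / (b - a) in gd *.
suff gen x : a <= x -> itv_partition x b s -> mesh_lt x s delta ->
    `|partition_sum (fun u v => (v - u) * g u) x s
      - \int[mu]_(t in `[x, b]) g t| <= k * (b - x) by exact: gen.
move=> {pas mas}; elim: s x => [|y s IHs] x ax pxs mxs.
  rewrite (itv_partition_nil pxs) partition_sum_nil set_itv1 Rintegral_set1.
  by rewrite !subrr normr0 mulr0.
have [xy yb pys] := itv_partition_consE pxs.
have [yxd mys] := mesh_lt_cons mxs.
have ay : a <= y := le_trans ax (ltW xy).
rewrite partition_sum_cons (Rintegral_itv_split ax (ltW xy) yb) opprD addrACA.
apply: le_trans (ler_normD _ _) _.
have -> : k * (b - x) = k * (y - x) + k * (b - y) by ring.
apply: lerD; last exact: IHs.
apply: Rintegral_near_constant => //; first exact: ltW.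
move=> t /[!in_itv]/= /andP[xt ty]; apply/ltW/gd; rewrite ?in_itv/=.
- by rewrite ax (le_trans (ltW xy)).
- by rewrite (le_trans ax xt) (le_trans ty).
- by rewrite distrC ger0_norm ?subr_ge0// (le_lt_trans _ yxd)// lerD2r.
Qed.

End RiemannSums.

(** * Matrix-valued integrands *)

Section ContinuousMatrixFunctions.
Context (R : realType).
Variables (a b : R).
Local Notation mu := (@lebesgue_measure R).

Definition mx_continuous (m n : nat) (G : R -> 'M[R]_(m, n)) : Prop :=
  forall i j, {within `[a, b], continuous (fun t => G t i j)}.

Lemma within_continuous_sum n (g : 'I_n -> R -> R) :
  (forall k, {within `[a, b], continuous (g k)}) ->
  {within `[a, b], continuous (fun t => \sum_k g k t)}.
Proof.
elim: n g => [|n IHn] g cg.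
  have -> : (fun t => \sum_(k < 0) g k t) = fun=> 0.
    by apply/funext => t; rewrite big_ord0.
  by apply: continuous_subspaceT => x; exact: cvg_cst.
have -> : (fun t => \sum_(k < n.+1) g k t) =
    g ord0 + (fun t => \sum_(k < n) g (lift ord0 k) t).
  by apply/funext => t; rewrite big_ord_recl.
by apply: within_continuousD => //; exact: IHn.
Qed.

Lemma mx_continuous_cst m n (A : 'M[R]_(m, n)) : mx_continuous (fun=> A).
Proof. by move=> i j; apply: continuous_subspaceT => x; exact: cvg_cst. Qed.

Lemma mx_continuous_tr m n (G : R -> 'M[R]_(m, n)) :
  mx_continuous G -> mx_continuous (fun t => (G t)^T).
Proof.
move=> cG i j; have -> : (fun t => (G t)^T i j) = fun t => G t j i.
  by apply/funext => t; rewrite mxE.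
exact: cG.
Qed.

Lemma eq_mx_continuous m n (G H : R -> 'M[R]_(m, n)) :
  (forall t, t \in `[a, b] -> G t = H t) -> mx_continuous G -> mx_continuous H.
Proof.
move=> GH cG i j; apply: subspace_eq_continuous (cG i j) => t; rewrite inE => tab.
exact: (congr1 (fun M : 'M[R]_(m, n) => M i j) (GH t tab)).
Qed.

Lemma mx_continuous_block m1 m2 n1 n2 (A : R -> 'M[R]_(m1, n1))
    (B : R -> 'M[R]_(m1, n2)) (C : R -> 'M[R]_(m2, n1)) (D : R -> 'M[R]_(m2, n2)) :
  mx_continuous A -> mx_continuous B -> mx_continuous C -> mx_continuous D ->
  mx_continuous (fun t => block_mx (A t) (B t) (C t) (D t)).
Proof.
move=> cA cB cC cD i j.
case: (split_ordP i) => k ->; case: (split_ordP j) => l ->.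
- have -> : (fun t => block_mx (A t) (B t) (C t) (D t) (lshift _ k) (lshift _ l))
    = fun t => A t k l by apply/funext => t; rewrite block_mxEul.
  exact: cA.
- have -> : (fun t => block_mx (A t) (B t) (C t) (D t) (lshift _ k) (rshift _ l))
    = fun t => B t k l by apply/funext => t; rewrite block_mxEur.
  exact: cB.
- have -> : (fun t => block_mx (A t) (B t) (C t) (D t) (rshift _ k) (lshift _ l))
    = fun t => C t k l by apply/funext => t; rewrite block_mxEdl.
  exact: cC.
- have -> : (fun t => block_mx (A t) (B t) (C t) (D t) (rshift _ k) (rshift _ l))
    = fun t => D t k l by apply/funext => t; rewrite block_mxEdr.
  exact: cD.
Qed.

Lemma mx_continuous_mul m n p (G : R -> 'M[R]_(m, n)) (H : R -> 'M[R]_(n, p)) :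
  mx_continuous G -> mx_continuous H -> mx_continuous (fun t => G t *m H t).
Proof.
move=> cG cH i j.
have -> : (fun t => (G t *m H t) i j) = fun t => \sum_k G t i k * H t k j.
  by apply/funext => t; rewrite mxE.
apply: within_continuous_sum => k x.
by apply: cvgM; [exact: cG|exact: cH].
Qed.

Lemma within_continuous_integrable_itv (g : R -> R) :
  {within `[a, b], continuous g} -> mu.-integrable `[a, b] (EFin \o g).
Proof. by move=> cg; exact: within_continuous_integrable cg _ _ _ _. Qed.

Lemma Rintegral_sum_continuous n (g : 'I_n -> R -> R) :
  (forall k, {within `[a, b], continuous (g k)}) ->
  \int[mu]_(t in `[a, b]) (\sum_k g k t) =
  \sum_k \int[mu]_(t in `[a, b]) g k t.
Proof.
elim: n g => [|n IHn] g cg.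
  rewrite big_ord0 (@eq_Rintegral _ _ _ _ _ (fun=> 0)).
    by rewrite /Rintegral integral0.
  by move=> t _; rewrite big_ord0.
rewrite big_ord_recl -IHn// -RintegralD//.
- by apply: eq_Rintegral => t _; rewrite big_ord_recl.
- exact: within_continuous_integrable_itv.
- by apply: within_continuous_integrable_itv; exact: within_continuous_sum.
Qed.

Lemma eq_mx_integral m n (G H : R -> 'M[R]_(m, n)) :
  (forall t, t \in `[a, b] -> G t = H t) -> mx_integral a b G = mx_integral a b H.
Proof.
move=> GH; apply/matrixP => i j; rewrite !mxE; apply: eq_Rintegral => t tab.
by rewrite GH//; move: tab; rewrite inE.
Qed.

Lemma tr_mx_integral m n (G : R -> 'M[R]_(m, n)) :
  (mx_integral a b G)^T = mx_integral a b (fun t => (G t)^T).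
Proof.
by apply/matrixP => i j; rewrite !mxE; apply: eq_Rintegral => t _; rewrite mxE.
Qed.

Lemma mx_integral_mull m n p (A : 'M[R]_(p, m)) (G : R -> 'M[R]_(m, n)) :
  mx_continuous G ->
  mx_integral a b (fun t => A *m G t) = A *m mx_integral a b G.
Proof.
move=> cG; apply/matrixP => i j; rewrite !mxE.
transitivity (\int[mu]_(t in `[a, b]) (\sum_k A i k * G t k j)).
  by apply: eq_Rintegral => t _; rewrite mxE.
rewrite Rintegral_sum_continuous => [|k].
  apply: eq_bigr => k _; rewrite mxE RintegralZl//.
  exact: within_continuous_integrable_itv.
by move=> x; apply: cvgM; [exact: cvg_cst|exact: cG].
Qed.

Lemma mx_integral_mulr m n p (A : 'M[R]_(n, p)) (G : R -> 'M[R]_(m, n)) :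
  mx_continuous G ->
  mx_integral a b (fun t => G t *m A) = mx_integral a b G *m A.
Proof.
move=> cG; apply: trmx_inj; rewrite trmx_mul !tr_mx_integral -mx_integral_mull.
  by apply: eq_mx_integral => t _; rewrite trmx_mul.
exact: mx_continuous_tr.
Qed.

End ContinuousMatrixFunctions.

(** * The isometry for stochastic integrals *)

Section WienerIsometry.
Context (R : realType) (d : measure_display) (T : measurableType d).
Variables (P : probability T R) (a b : R).
Hypothesis ab : a < b.
Variables (q : nat) (Y : R -> T -> 'cV[R]_q) (V : 'M[R]_q).
Hypothesis Y_L2 : forall t, t \in `[a, b] -> L2v P (Y t).
Hypothesis ccov_Y : forall s t, s \in `[a, b] -> t \in `[a, b] ->
  ccov P (Y s) (Y t) = Num.min s t *: V.

Lemma stoch_riemann_sum_nil (m : nat) (G : R -> 'M[R]_(m, q)) x :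
  stoch_riemann_sum x G Y [::] = fun=> 0.
Proof. by apply/funext => w; rewrite /stoch_riemann_sum big_ord0. Qed.

Lemma stoch_riemann_sum_cons (m : nat) (G : R -> 'M[R]_(m, q)) x y s :
  stoch_riemann_sum x G Y (y :: s) =
  fun w => G x *m (Y y w - Y x w) + stoch_riemann_sum y G Y s w.
Proof.
apply/funext => w.
exact: (partition_sum_cons (fun u v => G u *m (Y v w - Y u w))).
Qed.

Lemma itv_partition_ends (x y : R) s : a <= x -> itv_partition x b (y :: s) ->
  [/\ x < y, a <= y, x \in `[a, b], y \in `[a, b] & itv_partition y b s].
Proof.
move=> ax /itv_partition_consE[xy yb ys].
have ay := le_trans ax (ltW xy); split; rewrite ?in_itv/= ?ax ?ay//.
by rewrite (le_trans (ltW xy)).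
Qed.

Lemma stoch_riemann_sum_L2v (m : nat) (G : R -> 'M[R]_(m, q)) x s :
  a <= x -> itv_partition x b s -> L2v P (stoch_riemann_sum x G Y s).
Proof.
elim: s x => [|y s IHs] x ax ps.
  by rewrite stoch_riemann_sum_nil; exact: L2v_cst.
have [xy ay xab yab ys] := itv_partition_ends ax ps.
rewrite stoch_riemann_sum_cons.
by apply/L2v_add/IHs => //; apply/L2v_mul/L2v_sub; exact: Y_L2.
Qed.

(** For [u <= s <= t], the covariances of [Y u] with [Y s] and with [Y t] are
both [u V], so [Y u] is uncorrelated with the increments after [u]. *)
Lemma ccov_past_riemann_sum (m : nat) (G : R -> 'M[R]_(m, q)) u x s :
  a <= u -> u <= x -> itv_partition x b s ->
  ccov P (Y u) (stoch_riemann_sum x G Y s) = 0.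
Proof.
move=> au; elim: s x => [|y s IHs] x ux ps.
  by rewrite stoch_riemann_sum_nil ccov_cstr.
have [xy ay xab yab ys] := itv_partition_ends (le_trans au ux) ps.
have uab : u \in `[a, b].
  by move: xab; rewrite !in_itv/= au/= => /andP[_]; exact: le_trans.
have [Yu Yx Yy] : [/\ L2v P (Y u), L2v P (Y x) & L2v P (Y y)].
  by split; exact: Y_L2.
have uy := le_trans ux (ltW xy).
rewrite stoch_riemann_sum_cons ccovDr//.
- rewrite (IHs y)// addr0 ccovMr//; last exact: L2v_sub.
  by rewrite ccovBr// !ccov_Y// (min_l ux) (min_l uy) subrr mul0mx.
- exact/L2v_mul/L2v_sub.
- exact: stoch_riemann_sum_L2v.
Qed.

(** By orthogonality of increments only the diagonal terms survive, and an
increment over [(u, v)] has covariance matrix [(v - u) V]. *)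
Lemma ccov_riemann_sum (m n : nat) (G : R -> 'M[R]_(m, q))
    (H : R -> 'M[R]_(n, q)) x s : a <= x -> itv_partition x b s ->
  ccov P (stoch_riemann_sum x G Y s) (stoch_riemann_sum x H Y s) =
  partition_sum (fun u v => (v - u) *: (G u *m V *m (H u)^T)) x s.
Proof.
elim: s x => [|y s IHs] x ax ps.
  by rewrite partition_sum_nil stoch_riemann_sum_nil ccov_cstl.
have [xy ay xab yab ys] := itv_partition_ends ax ps.
have Yx : L2v P (Y x) by exact: Y_L2.
have Yy : L2v P (Y y) by exact: Y_L2.
have D2 := L2v_sub Yy Yx.
have SG := stoch_riemann_sum_L2v G ay ys.
have SH := stoch_riemann_sum_L2v H ay ys.
have past p (K : R -> 'M[R]_(p, q)) :
    ccov P (fun w => Y y w - Y x w) (stoch_riemann_sum y K Y s) = 0.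
  rewrite ccovBl//; last exact: stoch_riemann_sum_L2v.
  by rewrite !ccov_past_riemann_sum// ?subr0// ltW.
have DD : ccov P (fun w => Y y w - Y x w) (fun w => Y y w - Y x w) = (y - x) *: V.
  rewrite ccovBl// !ccovBr// !ccov_Y// !minxx (min_l (ltW xy)) (min_r (ltW xy)).
  by rewrite subrr subr0 scalerBl.
rewrite !stoch_riemann_sum_cons partition_sum_cons -IHs//.
have GD := L2v_mul (G x) D2; have HD := L2v_mul (H x) D2.
rewrite (ccovDl GD SG) ?(ccovDr HD SH) //; last exact: L2v_add.
rewrite !ccovMl// !ccovMr//.
rewrite past -[ccov P (stoch_riemann_sum y G Y s) (fun w => _)]tr_ccov past.
by rewrite DD trmx0 mulmx0 mul0mx addr0 add0r -scalemxAl -scalemxAr mulmxA.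
Qed.

Lemma stoch_integral_approx (m : nat) (G : R -> 'M[R]_(m, q))
    (I : T -> 'cV[R]_m) : is_stoch_integral P a b G Y I ->
  forall r, 0 < r -> exists2 delta : R, 0 < delta &
    forall s, itv_partition a b s -> mesh_lt a s delta -> forall i,
    ('E_P[fun w => ((I w i 0 - stoch_riemann_sum a G Y s w i 0) ^+ 2)%R]
      <= (r ^+ 2)%:E)%E.
Proof.
move=> [_ Ilim] r r0; have [delta d0 Id] := Ilim (r ^+ 2) (exprn_gt0 _ r0).
exists delta => // s ps ms i; apply: le_trans (Id s ps ms i).
by rewrite le_eqVlt; apply/orP; left; apply/eqP; congr expectation;
  apply/funext => w; rewrite !mxE.
Qed.

Lemma stoch_integral_L2v (m : nat) (G : R -> 'M[R]_(m, q)) (I : T -> 'cV[R]_m) :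
  is_stoch_integral P a b G Y I -> L2v P I.
Proof.
move=> /[dup] -[mI _] /stoch_integral_approx /(_ 1 ltr01) [delta d0 Id] i.
have [s ps ms] := exists_fine_partition ab d0.
have S2 := stoch_riemann_sum_L2v G (lexx a) ps i.
have -> : (fun w => I w i 0) = fun w =>
    (I w i 0 - stoch_riemann_sum a G Y s w i 0) + stoch_riemann_sum a G Y s w i 0.
  by apply/funext => w; rewrite subrK.
apply: (L2_add _ S2); apply: sqr_integrable_L2.
  by apply: measurable_funB => //; exact: L2_measurable S2.
by apply: le_lt_trans (Id s ps ms i) _; rewrite ltry.
Qed.

Lemma ccov_past_stoch_integral (m : nat) (G : R -> 'M[R]_(m, q))
    (I : T -> 'cV[R]_m) : is_stoch_integral P a b G Y I ->
  ccov P (Y a) I = 0.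
Proof.
move=> hI; have I2 := stoch_integral_L2v hI.
have aab : a \in `[a, b] by rewrite in_itv/= lexx ltW.
have Ya := Y_L2 aab.
apply/matrixP => i j; rewrite !mxE; apply: rcov_limit => // r r0.
have [delta d0 Id] := stoch_integral_approx hI r0.
have [s ps ms] := exists_fine_partition ab d0.
exists (fun w => Y a w i 0), (fun w => stoch_riemann_sum a G Y s w j 0); split=> //.
- exact: stoch_riemann_sum_L2v.
- have -> : (fun w => (Y a w i 0 - Y a w i 0) ^+ 2) = cst 0.
    by apply/funext => w; rewrite subrr expr0n.
  by rewrite expectation_cst lee_fin sqr_ge0.
- exact: Id.
- have /matrixP/(_ i j) := ccov_past_riemann_sum G (lexx a) (lexx a) ps.
  by rewrite !mxE => ->; rewrite subrr normr0 ltW.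
Qed.

(** The covariance matrices of the Riemann sums of both integrals over a common
fine partition are themselves Riemann sums of the integrand on the right. *)
Lemma wiener_isometry (m n : nat) (G : R -> 'M[R]_(m, q))
    (H : R -> 'M[R]_(n, q)) (I : T -> 'cV[R]_m) (J : T -> 'cV[R]_n) :
  mx_continuous a b (fun t => G t *m V *m (H t)^T) ->
  is_stoch_integral P a b G Y I -> is_stoch_integral P a b H Y J ->
  ccov P I J = mx_integral a b (fun t => G t *m V *m (H t)^T).
Proof.
move=> cGH hI hJ.
have I2 := stoch_integral_L2v hI; have J2 := stoch_integral_L2v hJ.
apply/matrixP => i j; rewrite !mxE; apply: rcov_limit => // r r0.
have [d1 d1_gt0 Id] := stoch_integral_approx hI r0.
have [d2 d2_gt0 Jd] := stoch_integral_approx hJ r0.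
have [d3 d3_gt0 Rd] := riemann_sum_cvg ab (cGH i j) r0.
have [|s ps ms] := @exists_fine_partition _ a b (Num.min d1 (Num.min d2 d3)) ab.
  by rewrite !lt_min d1_gt0 d2_gt0.
have [m1 m2 m3] : [/\ mesh_lt a s d1, mesh_lt a s d2 & mesh_lt a s d3].
  by split=> k ks; have := ms k ks; rewrite !lt_min => /and3P[].
exists (fun w => stoch_riemann_sum a G Y s w i 0),
  (fun w => stoch_riemann_sum a H Y s w j 0); split.
- exact: stoch_riemann_sum_L2v.
- exact: stoch_riemann_sum_L2v.
- exact: Id.
- exact: Jd.
- have /matrixP/(_ i j) := ccov_riemann_sum G H (lexx a) ps.
  rewrite mxE => ->; apply: le_trans (Rd s ps m3).
  rewrite le_eqVlt; apply/orP; left; apply/eqP; congr (`|_ - _|).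
  by rewrite summxE; apply: eq_bigr => k _; rewrite mxE.
Qed.

(** The initial value [Y a] is uncorrelated with both integrals and has
covariance matrix [a V]. *)
Lemma ccov_integral_add_initial (m n : nat) (G : R -> 'M[R]_(m, q))
    (H : R -> 'M[R]_(n, q)) (A : 'M[R]_(m, q)) (B : 'M[R]_(n, q))
    (I : T -> 'cV[R]_m) (J : T -> 'cV[R]_n) :
  mx_continuous a b (fun t => G t *m V *m (H t)^T) ->
  is_stoch_integral P a b G Y I -> is_stoch_integral P a b H Y J ->
  ccov P (fun w => I w + A *m Y a w) (fun w => J w + B *m Y a w) =
  mx_integral a b (fun t => G t *m V *m (H t)^T) + a *: (A *m V *m B^T).
Proof.
move=> cGH hI hJ.
have aab : a \in `[a, b] by rewrite in_itv/= lexx ltW.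
have Ya := Y_L2 aab.
have I2 := stoch_integral_L2v hI; have J2 := stoch_integral_L2v hJ.
have AY := L2v_mul A Ya; have BY := L2v_mul B Ya.
rewrite (ccovDl I2 AY) ?(ccovDr J2 BY)//; last exact: L2v_add.
rewrite (wiener_isometry cGH hI hJ) !ccovMl// !ccovMr//.
rewrite -(tr_ccov P (Y a) I).
rewrite (ccov_past_stoch_integral hI) (ccov_past_stoch_integral hJ).
rewrite trmx0 mul0mx mulmx0 addr0 add0r ccov_Y// minxx.
by rewrite -scalemxAl -scalemxAr mulmxA.
Qed.

End WienerIsometry.

(** * Derivative of the block design *)

Section Derivatives.
Context (R : realType).
Variables (a b : R).
Hypothesis ab : a < b.

(** Every point of a nondegenerate segment is an accumulation point of it, so
limits of difference quotients taken inside the segment are unique.  The witness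
near [t] lies to the right of [t], or to the left when [t = b]. *)
Lemma itv_quotient_proper t : t \in `[a, b] ->
  ProperFilter (within (`[a, b] `\ t) (nbhs t)).
Proof.
move=> tab; apply: within_nbhs_proper => B /nbhs_ballP[r /= r0 rB].
move: tab; rewrite in_itv/= => /andP[ta tb].
have [tb'|bt] := ltP t b.
- exists (t + Num.min (r / 2) (b - t)).
  have m0 : 0 < Num.min (r / 2) (b - t) by rewrite lt_min divr_gt0//= subr_gt0.
  have mb : Num.min (r / 2) (b - t) <= b - t by rewrite ge_min lexx orbT.
  have mr : Num.min (r / 2) (b - t) <= r / 2 by rewrite ge_min lexx.
  move: m0 mb mr; set m := Num.min _ _ => m0 mb mr; split.
    split; first by rewrite /= in_itv/=; lra.
    by move=> /= /eqP; rewrite -subr_eq0 addrAC subrr add0r gt_eqF.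
  apply: rB; rewrite /ball/= opprD addrA subrr add0r normrN gtr0_norm//; lra.
- have at' : a < t by exact: lt_le_trans ab bt.
  exists (t - Num.min (r / 2) (t - a)).
  have m0 : 0 < Num.min (r / 2) (t - a) by rewrite lt_min divr_gt0//= subr_gt0.
  have mb : Num.min (r / 2) (t - a) <= t - a by rewrite ge_min lexx orbT.
  have mr : Num.min (r / 2) (t - a) <= r / 2 by rewrite ge_min lexx.
  move: m0 mb mr; set m := Num.min _ _ => m0 mb mr; split.
    split; first by rewrite /= in_itv/=; lra.
    by move=> /= /eqP; rewrite -subr_eq0 addrAC subrr add0r oppr_eq0 gt_eqF.
  apply: rB; rewrite /ball/= opprD addrA subrr add0r opprK gtr0_norm//; lra.
Qed.

Lemma itv_deriv_cst (c : R) t : t \in `[a, b] -> itv_deriv a b (fun=> c) t = 0.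
Proof.
move=> tab; have := itv_quotient_proper tab => prop.
rewrite /itv_deriv /itv_quotient; under eq_fun do rewrite subrr mul0r.
by apply: cvg_lim => //; exact: cvg_cst.
Qed.

Lemma design_mxE (p1 p2 : nat) (f1 : R -> 'cV[R]_p1) (f2 : R -> 'cV[R]_p2) t :
  design_mx f1 f2 t = block_mx (f1 t) 0 0 (f2 t).
Proof. by rewrite /design_mx tr_block_mx !trmxK !trmx0. Qed.

Lemma mx_deriv_design (p1 p2 : nat) (f1 : R -> 'cV[R]_p1) (f2 : R -> 'cV[R]_p2)
    t : t \in `[a, b] ->
  mx_deriv a b (design_mx f1 f2) t =
  block_mx (mx_deriv a b f1 t) 0 0 (mx_deriv a b f2 t).
Proof.
move=> tab; apply/matrixP => i j; rewrite mxE.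
under eq_fun do rewrite design_mxE.
case: (split_ordP i) => k ->; case: (split_ordP j) => l ->.
- by rewrite block_mxEul mxE; under eq_fun do rewrite block_mxEul.
- rewrite block_mxEur mxE; under eq_fun do rewrite block_mxEur mxE.
  exact: itv_deriv_cst.
- rewrite block_mxEdl mxE; under eq_fun do rewrite block_mxEdl mxE.
  exact: itv_deriv_cst.
- by rewrite block_mxEdr mxE; under eq_fun do rewrite block_mxEdr.
Qed.

Lemma mx_deriv_continuous (p : nat) (f : R -> 'cV[R]_p) :
  C1_vec a b f -> mx_continuous a b (mx_deriv a b f).
Proof.
move=> C1f i j; have [_ cf] := C1f i.
by have -> : (fun t => mx_deriv a b f t i j) = itv_deriv a b (fun t => f t i 0)
  by apply/funext => t; rewrite mxE ord1.
Qed.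

Lemma design_deriv_continuous (p1 p2 : nat) (f1 : R -> 'cV[R]_p1)
    (f2 : R -> 'cV[R]_p2) : C1_vec a b f1 -> C1_vec a b f2 ->
  mx_continuous a b (mx_deriv a b (design_mx f1 f2)).
Proof.
move=> C1 C2; apply: eq_mx_continuous.
  by move=> t tab; rewrite mx_deriv_design.
by apply: mx_continuous_block; try exact: mx_deriv_continuous;
  exact: mx_continuous_cst.
Qed.

End Derivatives.

(** * Comparison of the two estimators *)

(** A nonnegative definite invertible matrix is positive definite.  With
[y = M x] and [x^T M x = 0], the quadratic form at [x + c y] is
[2 c |y|^2 + c^2 y^T M y], which is nonnegative for all [c] only if [y = 0]. *)
Lemma nonneg_definite_unit_eq0 (R : realType) (n : nat) (M : 'M[R]_n)
    (x : 'cV[R]_n) :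
  nonneg_definite M -> M \in unitmx -> (x^T *m M *m x) 0 0 = 0 -> x = 0.
Proof.
move=> [MT M0] uM xMx.
set y := M *m x.
pose m := (y^T *m M *m y) 0 0; pose k := (y^T *m y) 0 0.
have m0 : 0 <= m by exact: M0.
have kE : k = \sum_i y i 0 ^+ 2.
  by rewrite /k mxE; apply: eq_bigr => i _; rewrite mxE expr2.
have quad (c : R) : 0 <= c * k *+ 2 + c ^+ 2 * m.
  have := M0 (x + c *: y).
  have -> : (x + c *: y)^T *m M *m (x + c *: y) =
      x^T *m M *m x + (c * 2) *: (y^T *m y) + c ^+ 2 *: (y^T *m M *m y).
    have -> : (x + c *: y)^T = x^T + c *: y^T by rewrite linearD linearZ.
    have xMy : x^T *m M *m y = y^T *m y by rewrite /y trmx_mul MT.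
    have yMx : y^T *m M *m x = y^T *m y by rewrite -mulmxA.
    rewrite !(mulmxDl, mulmxDr, =^~ scalemxAl, =^~ scalemxAr).
    rewrite xMy yMx scalerA expr2 mulr2n mulrDr mulr1 scalerDl.
    by rewrite !addrA.
  have addE (A B : 'M[R]_1) : (A + B) 0 0 = A 0 0 + B 0 0 by rewrite mxE.
  have scaleE z (A : 'M[R]_1) : (z *: A) 0 0 = z * A 0 0 by rewrite mxE.
  by rewrite !(addE, scaleE) xMx add0r -/k -/m mulrAC mulr_natr.
(* [c = - k / (m + 1)] makes the form negative unless [k = 0]; the shift by [1]
   covers the case [m = 0]. *)
have ky : k = 0.
  have := quad (- k / (m + 1)).
  have m1 : 0 < m + 1 by rewrite ltr_wpDl.
  have -> : - k / (m + 1) * k *+ 2 + (- k / (m + 1)) ^+ 2 * m =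
     - (k ^+ 2 * (m + 2)) / (m + 1) ^+ 2 by field; rewrite lt0r_neq0.
  rewrite mulNr oppr_ge0 pmulr_lle0 ?invr_gt0 ?exprn_gt0//.
  rewrite pmulr_lle0; last by rewrite ltr_wpDl.
  by move=> k2; apply/eqP; rewrite -sqrf_eq0 eq_le k2 sqr_ge0.
have y0 : y = 0.
  apply/matrixP => i j; rewrite ord1 [RHS]mxE; apply/eqP; rewrite -sqrf_eq0.
  move/eqP: ky; rewrite kE psumr_eq0; last by move=> l _; exact: sqr_ge0.
  by move/allP => /(_ i); rewrite mem_index_enum => /(_ isT).
by rewrite -(mulKmx uM x) -/y y0 mulmx0.
Qed.

(** How a group sits in the joint model: [E] selects its parameters and [e] its
responses.  The first identity says that the rows of [G] selected by [E] are
those of [g] padded with zeros in the other columns, the second that the columns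
selected by [e] are those of [g] padded with zeros in the other rows. *)
Definition intertwines (R : realType) (p1 p q1 q : nat) (E : 'M[R]_(p1, p))
    (e : 'M[R]_(q1, q)) (G : 'M[R]_(p, q)) (g : 'M[R]_(p1, q1)) : Prop :=
  E *m G = g *m e /\ G *m e^T = E^T *m g.

Lemma intertwines_block (R : realType) (p1 p2 q1 q2 : nat)
    (g1 : 'M[R]_(p1, q1)) (g2 : 'M[R]_(p2, q2)) :
  intertwines (row_mx 1%:M 0) (row_mx 1%:M 0) (block_mx g1 0 0 g2) g1 /\
  intertwines (row_mx 0 1%:M) (row_mx 0 1%:M) (block_mx g1 0 0 g2) g2.
Proof.
by split; split; rewrite ?tr_row_mx ?trmx1 ?trmx0 ?mul_row_block ?mul_block_col
  ?mul_mx_row ?mul_col_mx ?(mul1mx, mul0mx, mulmx1, mulmx0, addr0, add0r).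
Qed.

Section SeparateVersusSimultaneous.
Context (R : realType) (d : measure_display) (T : measurableType d).
Variables (P : probability T R) (a b : R).
Hypothesis a_gt0 : 0 < a.
Hypothesis ab : a < b.
Variables (q : nat) (Y : R -> T -> 'cV[R]_q) (V : 'M[R]_q).
Hypothesis Y_L2 : forall t, t \in `[a, b] -> L2v P (Y t).
Hypothesis ccov_Y : forall s t, s \in `[a, b] -> t \in `[a, b] ->
  ccov P (Y s) (Y t) = Num.min s t *: V.
Hypothesis V_sym : V^T = V.
Hypothesis V_unit : V \in unitmx.

Variables (p : nat) (F : R -> 'M[R]_(p, q)).
Local Notation dF := (mx_deriv a b F).
Hypothesis dF_cont : mx_continuous a b dF.
Local Notation M := (blue_mx a b F V).

Let mx_continuous_mulr m n l (G : R -> 'M[R]_(m, n)) (A : 'M[R]_(n, l)) :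
  mx_continuous a b G -> mx_continuous a b (fun t => G t *m A).
Proof. by move=> cG; apply: mx_continuous_mul => //; exact: mx_continuous_cst. Qed.

Let invV_sym : (invmx V)^T = invmx V.
Proof. by rewrite trmx_inv V_sym. Qed.

Lemma ccov_blue_score (I : T -> 'cV[R]_p) :
  is_stoch_integral P a b (fun t => dF t *m invmx V) Y I ->
  ccov P (fun w => I w + a^-1 *: (F a *m invmx V *m Y a w))
         (fun w => I w + a^-1 *: (F a *m invmx V *m Y a w)) = M.
Proof.
move=> hI; under eq_fun do rewrite scalemxAl.
rewrite (ccov_integral_add_initial ab Y_L2 ccov_Y _ _ _ hI hI); last first.
  apply: mx_continuous_mul; first by do 2 apply: mx_continuous_mulr.
  by apply: mx_continuous_tr; exact: mx_continuous_mulr.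
rewrite /blue_mx; congr (_ + _).
  by apply: eq_mx_integral => t _; rewrite trmx_mul invV_sym mulmxKV// mulmxA.
rewrite linearZ/= -!scalemxAl -!scalemxAr !scalerA trmx_mul invV_sym.
by rewrite mulmxKV// mulmxA mulfV ?lt0r_neq0// mul1r.
Qed.

Section Group.
Variables (p1 : nat) (f : R -> 'cV[R]_p1).
Local Notation df := (mx_deriv a b f).
Hypothesis df_cont : mx_continuous a b df.
Variables (E : 'M[R]_(p1, p)) (e : 'M[R]_(1, q)).
Hypothesis EEt : E *m E^T = 1%:M.
Hypothesis F_block : intertwines E e (F a) (f a).
Hypothesis dF_block : forall t, t \in `[a, b] -> intertwines E e (dF t) (df t).
Local Notation M1 := (mar_mx a b f).

(** Each integrand of the joint information matrix is compressed by [E] to the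
same multiple of the integrand for the group alone, since [E G = g e] puts the
scalar [e V^-1 e^T] in the middle. *)
Lemma blue_mx_block :
  E *m M *m E^T = (e *m invmx V *m e^T) 0 0 *: M1.
Proof.
set c := (e *m invmx V *m e^T) 0 0.
have cE : e *m invmx V *m e^T = c%:M by rewrite [LHS]mx11_scalar.
have core (g : 'cV[R]_p1) (G : 'M[R]_(p, q)) : E *m G = g *m e ->
    E *m (G *m invmx V *m G^T) *m E^T = c *: (g *m g^T).
  move=> EG; rewrite !mulmxA EG -!mulmxA -trmx_mul EG trmx_mul.
  by rewrite !mulmxA -(mulmxA g) -(mulmxA g) cE mul_mx_scalar -scalemxAl.
rewrite /blue_mx mulmxDr mulmxDl scalerDr; congr (_ + _); last first.
  by rewrite -scalemxAr -scalemxAl (core _ _ F_block.1) !scalerA mulrC.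
have cM : mx_continuous a b (fun t => dF t *m invmx V *m (dF t)^T).
  by apply: mx_continuous_mul; [exact: mx_continuous_mulr|exact: mx_continuous_tr].
have cf : mx_continuous a b (fun t => df t *m (df t)^T).
  by apply: mx_continuous_mul => //; exact: mx_continuous_tr.
rewrite -mx_integral_mull// -mx_integral_mulr; last first.
  by apply: mx_continuous_mul => //; exact: mx_continuous_cst.
rewrite -[RHS]mul_scalar_mx -mx_integral_mull//.
apply: eq_mx_integral => t tab.
by rewrite (core _ _ (dF_block tab).1) mul_scalar_mx.
Qed.

(** If [v M1 = 0] then the quadratic form of [M] vanishes at [v E], whence
[v E = 0] and [v = v E E^T = 0]. *)
Lemma mar_mx_unit : nonneg_definite M -> M \in unitmx -> M1 \in unitmx.
Proof.
move=> psdM uM; rewrite -row_free_unit; apply/inj_row_free => v vM1.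
suff vE : (v *m E)^T = 0.
  by rewrite -[v]mulmx1 -EEt mulmxA -[v *m E]trmxK vE trmx0 mul0mx.
apply: (nonneg_definite_unit_eq0 psdM uM).
rewrite trmxK trmx_mul !mulmxA -(mulmxA v) -(mulmxA v) blue_mx_block.
by rewrite -scalemxAr vM1 scaler0 mul0mx mxE.
Qed.

Variables (y : R -> T -> 'cV[R]_1).
Hypothesis yE : forall t w, y t w = e *m Y t w.

Lemma stoch_integral_project (I1 : T -> 'cV[R]_p1) :
  is_stoch_integral P a b df y I1 ->
  is_stoch_integral P a b (fun t => df t *m e) Y I1.
Proof.
move=> [mI1 I1lim]; split=> // r r0; have [delta d0 Id] := I1lim r r0.
exists delta => // s ps ms i.
have <- : stoch_riemann_sum a df y s =
    stoch_riemann_sum a (fun t => df t *m e) Y s; last exact: Id.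
apply/funext => w; apply: eq_bigr => k _.
by rewrite !yE -mulmxBr mulmxA.
Qed.

(** The weight [V^-1] of the joint score cancels the covariance [V] of the
responses, leaving [g e G^T = g g^T E]. *)
Lemma ccov_mar_blue_score (I : T -> 'cV[R]_p) (I1 : T -> 'cV[R]_p1) :
  is_stoch_integral P a b (fun t => dF t *m invmx V) Y I ->
  is_stoch_integral P a b (fun t => df t *m e) Y I1 ->
  ccov P (fun w => I1 w + a^-1 *: (f a *m y a w))
         (fun w => I w + a^-1 *: (F a *m invmx V *m Y a w)) = M1 *m E.
Proof.
move=> hI hI1.
have -> : (fun w => I1 w + a^-1 *: (f a *m y a w)) =
    fun w => I1 w + (a^-1 *: (f a *m e)) *m Y a w.
  by apply/funext => w; rewrite yE mulmxA scalemxAl.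
have -> : (fun w => I w + a^-1 *: (F a *m invmx V *m Y a w)) =
    fun w => I w + (a^-1 *: (F a *m invmx V)) *m Y a w.
  by apply/funext => w; rewrite scalemxAl.
rewrite (ccov_integral_add_initial ab Y_L2 ccov_Y _ _ _ hI1 hI); last first.
  apply: mx_continuous_mul; first by do 2 apply: mx_continuous_mulr.
  by apply: mx_continuous_tr; exact: mx_continuous_mulr.
have core (g : 'cV[R]_p1) (G : 'M[R]_(p, q)) : G *m e^T = E^T *m g ->
    g *m e *m V *m (G *m invmx V)^T = g *m g^T *m E.
  move=> Ge; rewrite trmx_mul invV_sym mulmxA mulmxK//.
  by rewrite -mulmxA -[e]trmxK -trmx_mul Ge trmx_mul trmxK mulmxA.
rewrite /mar_mx mulmxDl; congr (_ + _).
  rewrite -mx_integral_mulr; last first.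
    by apply: mx_continuous_mul => //; exact: mx_continuous_tr.
  by apply: eq_mx_integral => t tab; rewrite core//; exact: (dF_block tab).2.
rewrite linearZ/= -!scalemxAl -!scalemxAr !scalerA core; last exact: F_block.2.
by rewrite mulfV ?lt0r_neq0// mul1r.
Qed.

(** The Gauss-Markov step: the block of the joint estimator has the same
covariance with the separate estimator as with itself, so the difference of the
covariance matrices is the covariance matrix of the difference. *)
Lemma blue_loewner_le_mar (I : T -> 'cV[R]_p) (I1 : T -> 'cV[R]_p1) :
  M \in unitmx ->
  is_stoch_integral P a b (fun t => dF t *m invmx V) Y I ->
  is_stoch_integral P a b df y I1 ->
  loewner_le (cov_mx P (fun w => E *m blue a b F V Y I w))
             (cov_mx P (mar a b f y I1)).
Proof.
move=> uM hI /stoch_integral_project hI1.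
set N := fun w => I w + a^-1 *: (F a *m invmx V *m Y a w).
set N1 := fun w => I1 w + a^-1 *: (f a *m y a w).
have Ya : L2v P (Y a) by apply: Y_L2; rewrite in_itv/= lexx ltW.
have N2 : L2v P N.
  rewrite /N; under eq_fun do rewrite scalemxAl.
  apply: L2v_add; last exact: L2v_mul.
  exact: (stoch_integral_L2v ab Y_L2 hI).
have N12 : L2v P N1.
  have -> : N1 = fun w => I1 w + (a^-1 *: (f a *m e)) *m Y a w.
    by apply/funext => w; rewrite /N1 yE mulmxA scalemxAl.
  apply: L2v_add; last exact: L2v_mul.
  exact: (stoch_integral_L2v ab Y_L2 hI1).
have covN : ccov P N N = M by exact: ccov_blue_score.
have covN1N : ccov P N1 N = M1 *m E by exact: ccov_mar_blue_score.
have psdM : nonneg_definite M by rewrite -covN; exact: ccov_nonneg_definite.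
have uM1 := mar_mx_unit psdM uM.
have MT : (invmx M)^T = invmx M by rewrite trmx_inv psdM.1.
set blue1 := fun w => E *m blue a b F V Y I w.
have blue1E : blue1 = fun w => (E *m invmx M) *m N w.
  by apply/funext => w; rewrite -mulmxA.
set mar1 := mar a b f y I1.
have mar1E : mar1 = fun w => invmx M1 *m N1 w by [].
have blue2 : L2v P blue1 by rewrite blue1E; exact: L2v_mul.
have mar2 : L2v P mar1 by rewrite mar1E; exact: L2v_mul.
have cov_blue : ccov P blue1 blue1 = E *m invmx M *m E^T.
  rewrite blue1E ccovMl//; last exact: L2v_mul.
  by rewrite ccovMr// covN trmx_mul MT !mulmxA mulmxKV.
have cov_mar_blue : ccov P mar1 blue1 = E *m invmx M *m E^T.
  rewrite mar1E blue1E ccovMl//; last exact: L2v_mul.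
  by rewrite ccovMr// covN1N trmx_mul MT !mulmxA mulVmx// mul1mx.
have -> : cov_mx P mar1 = ccov P mar1 mar1 by [].
have -> : cov_mx P blue1 = ccov P blue1 blue1 by [].
rewrite /loewner_le.
have -> : ccov P mar1 mar1 - ccov P blue1 blue1 =
    ccov P (fun w => mar1 w - blue1 w) (fun w => mar1 w - blue1 w).
  have D2 := L2v_sub mar2 blue2.
  rewrite ccovBl// !ccovBr// -(tr_ccov P mar1 blue1) cov_mar_blue -cov_blue.
  by rewrite tr_ccov subrr subr0.
by apply: ccov_nonneg_definite; exact: L2v_sub.
Qed.

End Group.
End SeparateVersusSimultaneous.

(** * The two-group model *)

Lemma Sigma_mx_sym (R : realType) (s1 s2 rho : R) :
  (Sigma_mx s1 s2 rho)^T = Sigma_mx s1 s2 rho.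
Proof. by rewrite /Sigma_mx tr_block_mx !tr_scalar_mx. Qed.

Lemma Sigma_mx_unit (R : realType) (s1 s2 rho : R) :
  0 < s1 -> 0 < s2 -> -1 < rho < 1 -> Sigma_mx s1 s2 rho \in unitmx.
Proof.
move=> s1_gt0 s2_gt0 /andP[rho_gt rho_lt].
have s1_neq0 := lt0r_neq0 s1_gt0; have s2_neq0 := lt0r_neq0 s2_gt0.
have rho_neq0 : 1 - rho ^+ 2 != 0.
  by apply: lt0r_neq0; nra.
pose c := (s1 * s2) ^+ 2 * (1 - rho ^+ 2).
(* The adjugate of Sigma divided by its determinant [c]. *)
pose W : 'M[R]_(1 + 1) := block_mx (s2 ^+ 2 / c)%:M (- (s1 * s2 * rho) / c)%:M
  (- (s1 * s2 * rho) / c)%:M (s1 ^+ 2 / c)%:M.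
suff VW : Sigma_mx s1 s2 rho *m W = 1%:M by have [] := mulmx1_unit VW.
rewrite mulmx_block -!scalar_mxM -!raddfD/= [RHS]scalar_mx_block.
rewrite -[0 in RHS](raddf0 (@scalar_mx R 1)).
by congr block_mx; congr _%:M; rewrite /c; field;
  rewrite ?s1_neq0 ?s2_neq0 ?rho_neq0.
Qed.

(** The mean is deterministic and drops out, and the noise [S eps] has
covariance matrix [S (min(s, t) I) S^T = min(s, t) S S]. *)
Lemma response_covariance (R : realType) (d : measure_display)
    (T : measurableType d) (P : probability T R) (a b : R)
    (p1 p2 : nat) (f1 : R -> 'cV[R]_p1) (f2 : R -> 'cV[R]_p2)
    (theta1 : 'cV[R]_p1) (theta2 : 'cV[R]_p2) (eps1 eps2 : R -> T -> R)
    (V S : 'M[R]_(1 + 1)) (s t : R) :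
  brownian_motion P a b eps1 -> brownian_motion P a b eps2 ->
  independent_processes P a b eps1 eps2 -> is_symmetric_sqrt V S ->
  s \in `[a, b] -> t \in `[a, b] ->
  let Y := response f1 f2 theta1 theta2 S eps1 eps2 in
  L2v P (Y t) /\ ccov P (Y s) (Y t) = Num.min s t *: V.
Proof.
move=> B1 B2 ind [[ST _] SS] sab tab Y.
have [Ws _] := ccov_brownian_pair B1 B2 ind sab tab.
have [Wt _] := ccov_brownian_pair B1 B2 ind tab tab.
have [_ cW] := ccov_brownian_pair B1 B2 ind sab tab.
have SWs := L2v_mul S Ws; have SWt := L2v_mul S Wt.
split; first by apply: L2v_add => //; exact: L2v_cst.
rewrite ccovDl//; [|exact: L2v_cst|by apply: L2v_add => //; exact: L2v_cst].
rewrite ccov_cstl add0r ccovDr//; last exact: L2v_cst.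
rewrite ccov_cstr add0r ccovMl// ccovMr// cW ST.
by rewrite mul_scalar_mx -scalemxAr SS.
Qed.

Theorem theorem3p2 (R : realType) (d : measure_display)
    (T : measurableType d) (P : probability T R)
    (a b : R) (ha : 0 < a) (hab : a < b)
    (p1 p2 : nat) (f1 : R -> 'cV[R]_p1) (f2 : R -> 'cV[R]_p2)
    (hf1 : C1_vec a b f1) (hf2 : C1_vec a b f2)
    (li1 : lin_indep_components a b f1) (li2 : lin_indep_components a b f2)
    (theta1 : 'cV[R]_p1) (theta2 : 'cV[R]_p2)
    (eps1 eps2 : R -> T -> R)
    (hB1 : brownian_motion P a b eps1) (hB2 : brownian_motion P a b eps2)
    (hind : independent_processes P a b eps1 eps2)
    (s1 s2 : R) (hs1 : 0 < s1) (hs2 : 0 < s2)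
    (rho : R) (hrho : -1 < rho < 1)
    (S : 'M[R]_(1 + 1)) (hS : is_symmetric_sqrt (Sigma_mx s1 s2 rho) S) :
  let V := Sigma_mx s1 s2 rho in
  let F := design_mx f1 f2 in
  let Y := response f1 f2 theta1 theta2 S eps1 eps2 in
  let Y1 := fun t w => usubmx (Y t w) in
  let Y2 := fun t w => dsubmx (Y t w) in
  blue_mx a b F V \in unitmx ->
  forall (I : T -> 'cV[R]_(p1 + p2)) (I1 : T -> 'cV[R]_p1)
         (I2 : T -> 'cV[R]_p2),
    is_stoch_integral P a b (fun t => mx_deriv a b F t *m invmx V) Y I ->
    is_stoch_integral P a b (mx_deriv a b f1) Y1 I1 ->
    is_stoch_integral P a b (mx_deriv a b f2) Y2 I2 ->
    let theta_blue := blue a b F V Y I in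
    loewner_le (cov_mx P (fun w => usubmx (theta_blue w)))
               (cov_mx P (mar a b f1 Y1 I1)) /\
    loewner_le (cov_mx P (fun w => dsubmx (theta_blue w)))
               (cov_mx P (mar a b f2 Y2 I2)).
Proof.
move=> V F Y Y1 Y2 uM I I1 I2 hI hI1 hI2 theta_blue.
have Y_L2 t : t \in `[a, b] -> L2v P (Y t).
  by move=> tab; have [] := response_covariance f1 f2 theta1 theta2 hB1 hB2 hind
    hS tab tab.
have ccov_Y s t : s \in `[a, b] -> t \in `[a, b] ->
    ccov P (Y s) (Y t) = Num.min s t *: V.
  by move=> sab tab; have [] := response_covariance f1 f2 theta1 theta2 hB1 hB2
    hind hS sab tab.
have V_sym : V^T = V := Sigma_mx_sym _ _ _.
have V_unit : V \in unitmx := Sigma_mx_unit hs1 hs2 hrho.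
have dF_cont := design_deriv_continuous hab hf1 hf2.
have row10 m n (A : 'M[R]_(m + n, 1)) : usubmx A = row_mx 1%:M 0 *m A.
  by rewrite -[in RHS](vsubmxK A) mul_row_col mul1mx mul0mx addr0.
have row01 m n (A : 'M[R]_(m + n, 1)) : dsubmx A = row_mx 0 1%:M *m A.
  by rewrite -[in RHS](vsubmxK A) mul_row_col mul1mx mul0mx add0r.
have rowK1 m n : row_mx 1%:M 0 *m (row_mx 1%:M 0 : 'M[R]_(m, m + n))^T = 1%:M.
  by rewrite tr_row_mx trmx1 trmx0 mul_row_col mulmx1 mulmx0 addr0.
have rowK2 m n : row_mx 0 1%:M *m (row_mx 0 1%:M : 'M[R]_(n, m + n))^T = 1%:M.
  by rewrite tr_row_mx trmx1 trmx0 mul_row_col mulmx1 mulmx0 add0r.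
split.
- have -> : (fun w => usubmx (theta_blue w)) =
      fun w => row_mx 1%:M 0 *m theta_blue w.
    by apply/funext => w; rewrite row10.
  apply: (blue_loewner_le_mar ha hab Y_L2 ccov_Y V_sym V_unit dF_cont
    (mx_deriv_continuous hf1) (rowK1 _ _) (e := row_mx 1%:M 0)) => //.
  + by rewrite design_mxE; exact: (intertwines_block _ _).1.
  + move=> t tab; rewrite mx_deriv_design//; exact: (intertwines_block _ _).1.
  + by move=> t w; rewrite /Y1 row10.
- have -> : (fun w => dsubmx (theta_blue w)) =
      fun w => row_mx 0 1%:M *m theta_blue w.
    by apply/funext => w; rewrite row01.
  apply: (blue_loewner_le_mar ha hab Y_L2 ccov_Y V_sym V_unit dF_cont
    (mx_deriv_continuous hf2) (rowK2 _ _) (e := row_mx 0 1%:M)) => //.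
  + by rewrite design_mxE; exact: (intertwines_block _ _).2.
  + move=> t tab; rewrite mx_deriv_design//; exact: (intertwines_block _ _).2.
  + by move=> t w; rewrite /Y2 row01.
Qed.
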